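(* For fixed $t\in(0,1]$, the function $p\mapsto \pi(p,t)$ is continuous on $[0,t]$.
   Context: For $p\in[0,1]$ let $\beta_1^p,\beta_2^p,\ldots$ be independent Bernoulli random variables with success probability $p$. A stake sequence is a sequence $\gamma=(c_1,c_2,\ldots)$ of non-negative reals with $c_1\ge c_2\ge\cdots$ and $\sum_i c_i=1$; write $S^p_\gamma=\sum_i c_i\beta^p_i$. For $0\le p\le t\le 1$ define $\pi(p,t)=\sup\{\mathbf P(S^p_\gamma\ge t)\mid \gamma \text{ a stake sequence}\}$. *)

(* Defs.v *)
From HB Require Import structures.
From mathcomp Require Import all_boot all_order all_algebra.
From mathcomp Require Import all_classical all_reals all_analysis.
Set Implicit Arguments. Unset Strict Implicit. Unset Printing Implicit Defensive.
Import Order.TTheory GRing.Theory Num.Theory.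
Import numFieldNormedType.Exports.
Local Open Scope classical_set_scope.
Local Open Scope ring_scope.

Definition stake_seq {R : realType} (c : nat -> R) : Prop :=
  (forall i, 0 <= c i) /\ (forall i, c i.+1 <= c i) /\
  (series c @ \oo --> (1 : R)).

Definition iid_bernoulli {R : realType} {d} {T : measurableType d}
  (P : probability T R) (p : R) (beta : nat -> T -> R) : Prop :=
  (forall i, measurable_fun setT (beta i)) /\
  (forall i w, beta i w = 0 \/ beta i w = 1) /\
  (forall (s : seq nat) (b : nat -> bool), uniq s ->
     P [set w | forall i, i \in s -> beta i w = (b i)%:R] =
     (\prod_(i <- s) (if b i then p else 1 - p))%:E).

(* S^p_gamma (w) = sum_i c_i beta_i(w) (a convergent non-negative series). *)
Definition stake_sum {R : realType} {T : Type}
  (c : nat -> R) (beta : nat -> T -> R) (w : T) : R :=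
  limn (series (fun i => c i * beta i w)).

Definition pi_fun {R : realType} {d} {T : measurableType d}
  (P : R -> probability T R) (beta : nat -> T -> R) (p t : R) : \bar R :=
  ereal_sup [set P p [set w | t <= stake_sum c beta w] | c in stake_seq].

(* Main.v *)
Require Import Defs.
From HB Require Import structures.
From mathcomp Require Import all_boot all_order all_algebra.
From mathcomp Require Import all_classical all_reals all_analysis.
From mathcomp Require Import measurable_realfun ring lra.
Import Order.TTheory GRing.Theory Num.Theory.
Import numFieldNormedType.Exports.
Local Open Scope classical_set_scope.
Local Open Scope ring_scope.

(* Let s_k be the total of the stakes from the k-th on.  The event S >= t lies
   between S_n >= t and S_n >= t - s_n, where S_n is the n-th partial sum, and the
   law of S_n depends on p in an n-Lipschitz way, uniformly in the stakes.

   For 0 < p < t it suffices to bound P(S >= t), uniformly in the stakes and for p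
   bounded away from 0 and t, by the value of a stake sequence of bounded length.
   If c_k <= eta s_k for some early k, then by Chebyshev the stakes from k on
   contribute at most about p s_k < t s_k, so S_k >= t (1 - s_k) up to small
   probability, and dividing by 1 - s_k gives a stake sequence of length k.
   Otherwise the s_k decay geometrically and many of the first K stakes are pairwise
   s_K-separated.  Flipping one of the variables shifts the window [t - s_K, t) by
   its stake, and the shifted windows are disjoint, so the window is unlikely.

   At p = t the Chebyshev estimate fails, but only continuity from the left matters:
   the same flipping argument for one fixed sequence gives monotonicity and lower
   semicontinuity.  At p = 0 Markov's inequality suffices, and for t = 1 one has
   p <= pi(p,1) <= 1. *)

(** * Finite weighted Bernoulli sums *)

Section FiniteSums.
Context {R : realFieldType}.
Implicit Types (c : nat -> R) (p a b r x y : R).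

(* The probability that [\sum_(i < n) c i * beta i >= a], for i.i.d. Bernoulli(p)
   variables [beta i], by conditioning on the last one. *)
Fixpoint bern_tail c p n a : R :=
  if n is m.+1 then p * bern_tail c p m (a - c m) + (1 - p) * bern_tail c p m a
  else (a <= 0)%R%:R.

Lemma bern_tail_ge0 c p n a : 0 <= p <= 1 -> 0 <= bern_tail c p n a.
Proof.
move=> /andP[p0 p1]; elim: n a => [|n IH] a /=; first exact: ler0n.
by rewrite addr_ge0// mulr_ge0// subr_ge0.
Qed.

Lemma bern_tail_le1 c p n a : 0 <= p <= 1 -> bern_tail c p n a <= 1.
Proof.
move=> /andP[p0 p1]; elim: n a => [|n IH] a /=; first by rewrite lern1 leq_b1.
by have := IH a; have := IH (a - c n); nra.
Qed.

Lemma bern_tail_anti c p n a b : 0 <= p <= 1 ->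
  a <= b -> bern_tail c p n b <= bern_tail c p n a.
Proof.
move=> /andP[p0 p1]; elim: n a b => [|n IH] a b ab /=.
  by rewrite ler_nat; case: (leP b 0) => // b0; rewrite (le_trans ab b0).
by apply: lerD; apply: ler_wpM2l; rewrite ?subr_ge0//; apply: IH; lra.
Qed.

(** A larger success probability moves weight to the branch with the lower threshold, which is at
    least as likely because [c n] is nonnegative. *)
Lemma bern_tail_mono c p q n a : (forall i, 0 <= c i) ->
  0 <= p -> p <= q -> q <= 1 -> bern_tail c p n a <= bern_tail c q n a.
Proof.
move=> c0 p0 pq q1; elim: n a => [|n IH] a //=.
have h : bern_tail c q n a <= bern_tail c q n (a - c n).
  by apply: bern_tail_anti; have := c0 n; lra.
have := IH a; have := IH (a - c n); nra.
Qed.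

(** Each variable costs at most [|p - q|], because its two branches are probabilities and differ by
    at most 1. The constant depends on neither the stakes nor the threshold. *)
Lemma bern_tail_lip c p q n a : 0 <= p <= 1 -> 0 <= q <= 1 ->
  bern_tail c p n a <= bern_tail c q n a + n%:R * `|p - q|.
Proof.
move=> hp hq; elim: n a => [|n IH] a /=; first by rewrite mul0r addr0.
set A := bern_tail c p n (a - c n); set A' := bern_tail c p n a.
set B := bern_tail c q n (a - c n); set B' := bern_tail c q n a.
have hA : A <= B + n%:R * `|p - q| by exact: IH.
have hB : A' <= B' + n%:R * `|p - q| by exact: IH.
have : (p - q) * (B - B') <= `|p - q|.
  rewrite (le_trans (ler_norm _))// normrM ler_piMr// ler_norml.
  have := bern_tail_ge0 c _ n a hq; have := bern_tail_le1 c _ n a hq.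
  have := bern_tail_ge0 c _ n (a - c n) hq.
  have := bern_tail_le1 c _ n (a - c n) hq.
  by rewrite -/B -/B'; lra.
have /andP[p0 p1] := hp; have p1' : 0 <= 1 - p by lra.
have := ler_wpM2l p0 hA; have := ler_wpM2l p1' hB.
by rewrite -natr1; lra.
Qed.

Lemma bern_tail_scale c p n a x : 0 < x ->
  bern_tail (fun i => c i / x) p n (a / x) = bern_tail c p n a.
Proof.
move=> x0; elim: n a => [|n IH] a /=; first by rewrite pmulr_lle0// invr_gt0.
by rewrite -mulrBl !IH.
Qed.

Lemma eq_bern_tail c c' p n a : (forall i, (i < n)%N -> c i = c' i) ->
  bern_tail c p n a = bern_tail c' p n a.
Proof.
elim: n a => [|n IH] a //= h.
by rewrite h// !IH// => i /ltnW; exact: h.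
Qed.

(* Union bound: a sum reaching [a + b] has its head reach [a] or its tail [b]. *)
Lemma bern_tail_split c p k m a b : 0 <= p <= 1 ->
  bern_tail c p (k + m) (a + b) <=
  bern_tail c p k a + bern_tail (fun i => c (k + i)%N) p m b.
Proof.
move=> hp; elim: m b => [|m IH] b.
  rewrite addn0 /=; case: (leP b 0) => b0 /=.
    by have := bern_tail_le1 c _ k (a + b) hp; have := bern_tail_ge0 c _ k a hp; lra.
  by rewrite addr0; apply: bern_tail_anti => //; lra.
rewrite addnS /=; have := IH b; have := IH (b - c (k + m)%N).
rewrite addrA => h1 h2.
have /andP[p0 p1] := hp.
have := ler_wpM2l p0 h1.
have p1' : 0 <= 1 - p by lra.
by have := ler_wpM2l p1' h2; lra.
Qed.

(* Chebyshev's inequality around [y]; the right-hand side bounds the variance plus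
   the squared bias. *)
Lemma bern_tail_second_moment c p n b y : 0 <= p <= 1 -> y <= b ->
  bern_tail c p n b * (b - y) ^+ 2 <=
  \sum_(0 <= i < n) c i ^+ 2 + (p * (\sum_(0 <= i < n) c i) - y) ^+ 2.
Proof.
move=> hp; have /andP[p0 p1] := hp; elim: n b y => [|n IH] b y yb /=.
  rewrite !big_geq// mulr0 add0r sub0r sqrrN.
  case: (leP b 0) => b0 /=; last by rewrite mul0r sqr_ge0.
  by rewrite mul1r; nra.
rewrite !big_nat_recr//=.
have h1 := IH b y yb.
have h2 : bern_tail c p n (b - c n) * (b - y) ^+ 2 <=
  \sum_(0 <= i < n) c i ^+ 2 + (p * (\sum_(0 <= i < n) c i) - (y - c n)) ^+ 2.
  have -> : b - y = (b - c n) - (y - c n) by ring.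
  by apply: IH; lra.
move: h1 h2; move: (\sum_(_ <= _ < _) _) (\sum_(_ <= _ < _) _) => V M h1 h2.
have p1' : 0 <= 1 - p by lra.
have := ler_wpM2l p0 h2; have := ler_wpM2l p1' h1.
(* Averaging the two branches produces the extra variance [p * (1 - p) * c n ^+ 2], which the new
   summand [c n ^+ 2] absorbs. *)
have : p ^+ 2 * c n ^+ 2 + 0 <= p ^+ 2 * c n ^+ 2 + c n ^+ 2 * (1 - p * (1 - p)).
  by rewrite lerD2l mulr_ge0 ?sqr_ge0//; nra.
by move: (bern_tail _ _ _ _) (bern_tail _ _ _ _) => A B; nra.
Qed.

(** For [r >= 0], the probability that the sum falls in the half-open interval from [a] to
    [a + r]. *)
Definition bern_window c p n r a := bern_tail c p n a - bern_tail c p n (a + r).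

Lemma bern_windowS c p n r a : bern_window c p n.+1 r a =
  p * bern_window c p n r (a - c n) + (1 - p) * bern_window c p n r a.
Proof. by rewrite /bern_window/= (addrAC a r); ring. Qed.

Lemma bern_window_ge0 c p n r a : 0 <= p <= 1 -> 0 <= r ->
  0 <= bern_window c p n r a.
Proof. by move=> hp r0; rewrite subr_ge0 bern_tail_anti//; lra. Qed.

(** Windows of width [r] starting at points [r] apart are disjoint. With no variables the sum is 0
    and at most one window contains it; the bound survives averaging over each further variable. *)
Lemma sum_bern_window_le1 c p n r a (xs : seq R) : 0 <= p <= 1 -> 0 <= r ->
  pairwise (fun x y => r <= `|x - y|) xs ->
  \sum_(x <- xs) bern_window c p n r (a + x) <= 1.
Proof.
move=> hp r0 xsP; have /andP[p0 p1] := hp; elim: n a => [|n IH] a.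
  elim: xs xsP => [|x xs IHx]; first by rewrite big_nil.
  rewrite pairwise_cons big_cons => /andP[/allP xP /IHx {}IHx].
  have [ax|ax] := boolP ((a + x <= 0) && (0 < a + x + r)).
    rewrite big1_seq ?addr0 => [|y /= yxs].
      by rewrite /bern_window/= (le_trans (y := (a + x <= 0)%R%:R)) ?gerBl ?ler0n// lern1 leq_b1.
    have := xP _ yxs; rewrite /bern_window/=.
    case: (leP (a + y) 0); case: (leP (a + y + r) 0) => //=; rewrite ?subrr//; first last.
      by move: ax; lra.
    by move=> h1 h2; rewrite ler_normr; move: ax; lra.
  have -> : bern_window c p 0 r (a + x) = 0; last by rewrite add0r.
  move: ax; rewrite negb_and /bern_window/= -ltNge -leNgt.
  case: (leP (a + x) 0); case: (leP (a + x + r) 0) => //=; rewrite ?subrr//.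
  by lra.
under eq_bigr do rewrite bern_windowS.
rewrite big_split/= -!mulr_sumr.
under eq_bigr do rewrite addrAC.
by have := IH a; have := IH (a - c n); nra.
Qed.

(* Resampling the [i]-th variable shifts the window by [c i]. *)
Lemma bern_window_flip c p n r a i : 0 <= p <= 1 -> 0 <= r -> (i < n)%N ->
  p * (1 - p) * bern_window c p n r a <=
  bern_window c p n r (a + c i) + bern_window c p n r (a - c i).
Proof.
move=> hp r0; have /andP[p0 p1] := hp; have p1' : 0 <= 1 - p by lra.
elim: n a => [|n IH] a //; rewrite ltnS leq_eqVlt => /predU1P[->|lin].
  (* Of the four terms on the right, those at [a + c n] and [a - c n - c n] are dropped as
     nonnegative; the other two dominate the left side. *)
  rewrite !bern_windowS addrK.
  have h b := bern_window_ge0 c p n r b hp r0.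
  have hA := h (a - c n); have hB := h a.
  have h1 := mulr_ge0 p0 (h (a - c n - c n)); have h2 := mulr_ge0 p1' (h (a + c n)).
  have p2 : 0 <= p * (1 - p) by exact: mulr_ge0.
  have : p * (1 - p) * p * bern_window c p n r (a - c n) <=
         (1 - p) * bern_window c p n r (a - c n) by apply: ler_wpM2r => //; nra.
  have : p * (1 - p) * (1 - p) * bern_window c p n r a <=
         p * bern_window c p n r a by apply: ler_wpM2r => //; nra.
  by lra.
have := IH a lin; have := IH (a - c n) lin; rewrite !bern_windowS.
rewrite (addrAC a (- c n)) (addrAC a (- c n) (- c i)).
by move=> /(ler_wpM2l p0) ? /(ler_wpM2l p1') ?; lra.
Qed.

(** Sum the flip inequality over [s]. The windows shifted by [c i] are disjoint, and so are those
    shifted by [- c i]; each family contributes at most 1 to the bound 2. *)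
Lemma bern_window_anticoncentration c p n r a (s : seq nat) :
  0 <= p <= 1 -> 0 <= r -> all (gtn n) s ->
  pairwise (fun i j => r <= c i - c j) s ->
  (size s)%:R * (p * (1 - p) * bern_window c p n r a) <= 2.
Proof.
move=> hp r0 /allP sn sP.
have -> : (size s)%:R * (p * (1 - p) * bern_window c p n r a) =
    \sum_(i <- s) p * (1 - p) * bern_window c p n r a.
  by rewrite big_const_seq count_predT iter_addr_0 mulr_natl.
have : \sum_(i <- s) p * (1 - p) * bern_window c p n r a <=
    \sum_(i <- s) bern_window c p n r (a + c i) +
    \sum_(i <- s) bern_window c p n r (a - c i).
  rewrite -big_split/= big_seq [leRHS]big_seq; apply: ler_sum => i /sn ni.
  exact: bern_window_flip.
have hs (f : nat -> R) : (forall i j, `|f i - f j| = `|c i - c j|) ->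
    \sum_(i <- s) bern_window c p n r (a + f i) <= 1.
  move=> fE; rewrite -(big_map f xpredT (fun x => bern_window c p n r (a + x))).
  apply: sum_bern_window_le1 => //; rewrite pairwise_map.
  apply: sub_pairwise sP => i j /= h.
  by rewrite fE (le_trans h)// ler_norm.
have := hs c (fun _ _ => erefl).
have : \sum_(i <- s) bern_window c p n r (a - c i) <= 1.
  by apply: hs => i j; rewrite opprK addrC distrC.
by lra.
Qed.

Lemma bern_tail_markov (c : nat -> R) p n a :
  (forall i, 0 <= c i) -> 0 <= p <= 1 ->
  bern_tail c p n a * a <= p * \sum_(0 <= i < n) c i.
Proof.
move=> c0 hp; have /andP[p0 p1] := hp; have p1' : 0 <= 1 - p by lra.
elim: n a => [|n IH] a /=.
  by rewrite big_geq// mulr0; case: (leP a 0) => a0 /=; rewrite ?mul1r ?mul0r.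
rewrite big_nat_recr//=.
have := ler_wpM2l p0 (IH (a - c n)); have := ler_wpM2l p1' (IH a).
have : p * (bern_tail c p n (a - c n) * c n) <= p * c n.
  by apply: ler_wpM2l => //; rewrite ler_piMl// bern_tail_le1.
by lra.
Qed.

Lemma bern_tail_eq0 (c : nat -> R) p n a :
  (forall i, 0 <= c i) -> \sum_(0 <= i < n) c i < a -> bern_tail c p n a = 0.
Proof.
move=> c0; elim: n a => [|n IH] a /=; first by rewrite big_geq// => /lt_geF ->.
rewrite big_nat_recr//= => h.
by rewrite !IH ?mulr0 ?addr0//; have := c0 n; lra.
Qed.

End FiniteSums.

(** * Infinite stake sequences *)

Definition stake_rest {R : realType} (c : nat -> R) n : R :=
  1 - \sum_(0 <= i < n) c i.

Section StakeSequences.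
Context {R : realType} {c : nat -> R}.
Hypothesis hc : stake_seq c.

Let c_ge0 i : 0 <= c i. Proof. by have [] := hc. Qed.

Lemma stake_anti i j : (i <= j)%N -> c j <= c i.
Proof.
have [_ [cS _]] := hc; elim: j => [|j IH]; first by rewrite leqn0 => /eqP ->.
by rewrite leq_eqVlt => /predU1P[->//|/IH]; exact: le_trans.
Qed.

Lemma stake_restS n : stake_rest c n.+1 = stake_rest c n - c n.
Proof. by rewrite /stake_rest big_nat_recr//=; ring. Qed.

Lemma stake_rest_anti m n : (m <= n)%N -> stake_rest c n <= stake_rest c m.
Proof.
elim: n => [|n IH]; first by rewrite leqn0 => /eqP ->.
rewrite leq_eqVlt => /predU1P[->//|/IH]; rewrite stake_restS.
by have := c_ge0 n; lra.
Qed.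

Lemma stake_rest_cvg0 : stake_rest c @ \oo --> (0 : R).
Proof.
have [_ [_ cvg1]] := hc; rewrite -[X in _ --> X](subrr 1).
by apply: cvgB => //; exact: cvg_cst.
Qed.

Lemma stake_rest_ge0 n : 0 <= stake_rest c n.
Proof.
rewrite -(cvg_lim _ stake_rest_cvg0)//; apply: nonincreasing_cvgn_ge.
  by move=> i j; exact: stake_rest_anti.
by apply/cvg_ex; exists 0; exact: stake_rest_cvg0.
Qed.

Lemma stake_le_rest n : c n <= stake_rest c n.
Proof. by have := stake_rest_ge0 n.+1; rewrite stake_restS; lra. Qed.

Lemma stake_rest_small e : 0 < e ->
  exists N, forall n, (N <= n)%N -> stake_rest c n <= e.
Proof.
move=> e0; have /cvgrPdist_le/(_ e e0)[N _ hN] := stake_rest_cvg0.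
exists N => n /hN /=; rewrite sub0r normrN; apply: le_trans; exact: ler_norm.
Qed.

Lemma stake_sum_block k m :
  \sum_(0 <= i < m) c (k + i)%N = stake_rest c k - stake_rest c (k + m).
Proof.
elim: m => [|m IH]; first by rewrite big_geq// addn0 subrr.
by rewrite big_nat_recr//= IH addnS stake_restS; ring.
Qed.

Section Outcome.
Context {x : nat -> R}.
Hypothesis x01 : forall i, 0 <= x i <= 1.

Let cx_ge0 i : 0 <= c i * x i.
Proof. by have /andP[? ?] := x01 i; exact: mulr_ge0. Qed.

Let cx_le i : c i * x i <= c i.
Proof. by have /andP[? ?] := x01 i; rewrite ler_piMr. Qed.

Let cvg_cx : cvgn (series (fun i => c i * x i)).
Proof.
apply: (@series_le_cvg _ _ c) => //.
by have [_ [_ h]] := hc; apply/cvg_ex; exists 1.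
Qed.

Lemma stake_partial_le_lim n :
  \sum_(0 <= i < n) c i * x i <= limn (series (fun i => c i * x i)).
Proof. by apply: (nondecreasing_cvgn_le _ cvg_cx); exact: nondecreasing_series. Qed.

(** Counting all undecided outcomes as successes bounds the stake sum from above; deciding one more
    can only lower this bound. *)
Let partial_rest_anti m n : (m <= n)%N ->
  \sum_(0 <= i < n) c i * x i + stake_rest c n <=
  \sum_(0 <= i < m) c i * x i + stake_rest c m.
Proof.
elim: n => [|n IH]; first by rewrite leqn0 => /eqP ->.
rewrite leq_eqVlt => /predU1P[->//|/IH].
by rewrite stake_restS big_nat_recr//=; have := cx_le n; lra.
Qed.

Let partial_rest_cvg :
  (fun n => \sum_(0 <= i < n) c i * x i + stake_rest c n) @ \oo -->
  limn (series (fun i => c i * x i)).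
Proof.
rewrite -[X in _ --> X]addr0; apply: cvgD; [exact: cvg_cx|exact: stake_rest_cvg0].
Qed.

Lemma stake_lim_le_partial n :
  limn (series (fun i => c i * x i)) <=
  \sum_(0 <= i < n) c i * x i + stake_rest c n.
Proof.
rewrite -(cvg_lim _ partial_rest_cvg)//.
apply: (@nonincreasing_cvgn_ge _ (fun n => _ + _)).
  by move=> i j; exact: partial_rest_anti.
by apply/cvg_ex; eexists; exact: partial_rest_cvg.
Qed.

Lemma stake_lim_ge t :
  (forall n, t - stake_rest c n <= \sum_(0 <= i < n) c i * x i) ->
  t <= limn (series (fun i => c i * x i)).
Proof.
move=> h; rewrite -(cvg_lim _ partial_rest_cvg)//; apply: limr_ge.
  by apply/cvg_ex; eexists; exact: partial_rest_cvg.
by near=> n; rewrite -lerBlDr.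
Unshelve. all: by end_near. Qed.

End Outcome.
End StakeSequences.

(** * Probabilities of stake events in terms of finite tails *)

Section Bridge.
Context {R : realType} {d : measure_display} {T : measurableType d}.
Context {P : probability T R} {p : R} {beta : nat -> T -> R}.
Hypothesis hP : iid_bernoulli P p beta.

Lemma bernoulli01 i w : 0 <= beta i w <= 1.
Proof. by have [_ [/(_ i w)[]-> _]] := hP; rewrite ?lexx ?ler01. Qed.

Lemma measurable_partial (c : nat -> R) n a :
  measurable [set w | a <= \sum_(0 <= i < n) c i * beta i w].
Proof.
have mS : measurable_fun setT (fun w => \sum_(0 <= i < n) c i * beta i w).
  apply: measurable_sum => i; apply: measurable_funM; first exact: measurable_cst.
  by have [+ _] := hP; apply.
rewrite -[X in measurable X]setTI.
have -> : [set w | a <= \sum_(0 <= i < n) c i * beta i w] =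
    (fun w => \sum_(0 <= i < n) c i * beta i w) @^-1` `[a, +oo[.
  by apply/seteqP; split => w /=; rewrite in_itv/= andbT.
exact: mS.
Qed.

Lemma measurable_cylinder (s : seq nat) (b : nat -> bool) :
  measurable [set w | forall i, i \in s -> beta i w = (b i)%:R].
Proof.
have -> : [set w | forall i, i \in s -> beta i w = (b i)%:R] =
    \bigcap_(i in [set i | i \in s]) (beta i @^-1` [set (b i)%:R]).
  by apply/seteqP; split => w /= h i; exact: h.
apply: bigcap_measurableType => i _; rewrite -[X in measurable X]setTI.
by have [+ _] := hP => /(_ i); apply.
Qed.

(** Independence is given only through cylinders, so the induction that peels off the last variable
    carries along a cylinder on the indices already removed. *)
Lemma prob_partial_cylinder (c : nat -> R) n a (s : seq nat) (b : nat -> bool) :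
  uniq s -> all (leq n) s ->
  P ([set w | a <= \sum_(0 <= i < n) c i * beta i w] `&`
     [set w | forall i, i \in s -> beta i w = (b i)%:R]) =
  (bern_tail c p n a * \prod_(i <- s) (if b i then p else 1 - p))%:E.
Proof.
elim: n a s b => [|n IH] a s b us sn /=.
  have [_ [_ hs]] := hP.
  rewrite (_ : [set w | _] = if a <= 0 then setT else set0); last first.
    by case: (leP a 0) => a0; apply/seteqP; split => w //=; rewrite big_geq// leNgt a0.
  case: (leP a 0) => _; first by rewrite setTI hs// mul1r.
  by rewrite set0I measure0 mul0r.
(* The cylinder on [s] extended by the value [v] at index [n]. *)
pose bb v i := if i == n then v else b i.
have nsn : n \notin s by apply/negP => /(allP sn); rewrite ltnn.
have usn : uniq (n :: s) by rewrite /= nsn.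
have alln : all (leq n) (n :: s).
  by rewrite /= leqnn; apply: sub_all sn => i /ltnW.
have bbE v : \prod_(i <- s) (if bb v i then p else 1 - p) =
    \prod_(i <- s) (if b i then p else 1 - p).
  apply: eq_big_seq => i si; rewrite /bb; case: eqP => // ein.
  by rewrite -ein si in nsn.
have cylE v : [set w | forall i, i \in n :: s -> beta i w = (bb v i)%:R] =
    [set w | beta n w = v%:R] `&` [set w | forall i, i \in s -> beta i w = (b i)%:R].
  apply/seteqP; split => w /=.
    move=> h; split; first by rewrite h ?mem_head// /bb eqxx.
    move=> i si; rewrite h ?inE ?si ?orbT// /bb; case: eqP => // ein.
    by rewrite -ein si in nsn.
  move=> [h1 h2] i; rewrite inE /bb; case: eqP => [->//|_ /=]; exact: h2.
have -> : [set w | a <= \sum_(0 <= i < n.+1) c i * beta i w] `&`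
     [set w | forall i, i \in s -> beta i w = (b i)%:R] =
   ([set w | a - c n <= \sum_(0 <= i < n) c i * beta i w] `&`
     [set w | forall i, i \in n :: s -> beta i w = (bb true i)%:R]) `|`
   ([set w | a <= \sum_(0 <= i < n) c i * beta i w] `&`
     [set w | forall i, i \in n :: s -> beta i w = (bb false i)%:R]).
  rewrite !cylE; apply/seteqP; split => w /=; rewrite big_nat_recr//=.
    move=> [h1 h2]; have [_ [/(_ n w)[bn|bn] _]] := hP.
      by right; move: h1; rewrite bn mulr0 addr0.
    by left; split => //; move: h1; rewrite bn mulr1 lerBlDr.
  by move=> [|] [h1 [bn h2]]; split => //; rewrite bn; move: h1;
    rewrite /= ?mulr1 ?mulr0 ?addr0 ?lerBlDr.
rewrite measureU; first last.
- rewrite !cylE; apply/seteqP; split => w //= -[[_ [h1 _]] [_ [h2 _]]].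
  by move: h2; rewrite h1 => /eqP; rewrite oner_eq0.
- by apply: measurableI; [exact: measurable_partial|exact: measurable_cylinder].
- by apply: measurableI; [exact: measurable_partial|exact: measurable_cylinder].
transitivity ((bern_tail c p n (a - c n) *
      \prod_(i <- n :: s) (if bb true i then p else 1 - p))%:E +
    (bern_tail c p n a * \prod_(i <- n :: s) (if bb false i then p else 1 - p))%:E)%E.
  by congr (_ + _)%E; exact: IH.
rewrite -EFinD.
rewrite !big_cons !bbE /bb eqxx; congr (_%:E); ring.
Qed.

Lemma prob_partial (c : nat -> R) n a :
  P [set w | a <= \sum_(0 <= i < n) c i * beta i w] = (bern_tail c p n a)%:E.
Proof.
have := prob_partial_cylinder c n a nil (fun=> true) isT isT.
rewrite big_nil mulr1 => <-; congr (P _).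
by apply/seteqP; split => w //= [].
Qed.

(** Partial sum plus rest decreases to the stake sum, so the event is a countable intersection of
    events in finitely many variables, hence measurable. *)
Lemma stake_event_bigcap (c : nat -> R) t : stake_seq c ->
  [set w | t <= stake_sum c beta w] =
  \bigcap_n [set w | t - stake_rest c n <= \sum_(0 <= i < n) c i * beta i w].
Proof.
move=> hc; apply/seteqP; split => w /=.
  move=> h n _ /=; rewrite lerBlDr (le_trans h)//.
  exact: (stake_lim_le_partial hc (x := fun i => beta i w) (bernoulli01 ^~ w)).
move=> h; apply: (stake_lim_ge hc (x := fun i => beta i w) (bernoulli01 ^~ w)).
by move=> n; exact: h.
Qed.

Lemma measurable_stake_event (c : nat -> R) t : stake_seq c ->
  measurable [set w | t <= stake_sum c beta w].
Proof.
move=> /stake_event_bigcap->; apply: bigcap_measurableType => n _.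
exact: measurable_partial.
Qed.

Lemma prob_stake_le (c : nat -> R) t n : stake_seq c ->
  (P [set w | (t <= stake_sum c beta w)%R] <=
   (bern_tail c p n (t - stake_rest c n))%:E)%E.
Proof.
move=> hc; rewrite -prob_partial; apply: le_measure; rewrite ?inE.
- exact: measurable_stake_event.
- exact: measurable_partial.
- by rewrite stake_event_bigcap//; exact: bigcap_inf.
Qed.

Lemma prob_stake_ge (c : nat -> R) t n : stake_seq c ->
  ((bern_tail c p n t)%:E <= P [set w | (t <= stake_sum c beta w)%R])%E.
Proof.
move=> hc; rewrite -prob_partial; apply: le_measure; rewrite ?inE.
- exact: measurable_partial.
- exact: measurable_stake_event.
- move=> w /= h; rewrite (le_trans h)//.
  exact: (stake_partial_le_lim hc (x := fun i => beta i w) (bernoulli01 ^~ w)).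
Qed.

End Bridge.

(** * Truncation of stake sequences *)

Section Approximation.
Context {R : realType}.
Implicit Types (c : nat -> R) (p q a e r t : R).

(** Stakes tend to 0, so a next stake of size at most [r] exists. The invariant [r + r <= c i] keeps
    it at distance [r] from those already chosen, and half of it is the new [r]. *)
Lemma separated_stakes c m : stake_seq c -> (forall i, 0 < c i) ->
  exists (s : seq nat) r, [/\ 0 < r, size s = m,
    pairwise (fun i j => r <= c i - c j) s & all (fun i => r + r <= c i) s].
Proof.
move=> hc c_gt0; elim: m => [|m [s [r [r0 ss sP sa]]]].
  by exists nil, 1.
have [i hi] := stake_rest_small hc _ r0.
have cir : c i <= r by rewrite (le_trans (stake_le_rest hc i))// hi.
exists (rcons s i), (c i / 2); split.
- by rewrite divr_gt0.
- by rewrite size_rcons ss.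
- rewrite pairwise_rcons; apply/andP; split.
    by apply: sub_all sa => j /=; have := c_gt0 i; lra.
  by apply: sub_pairwise sP => j k /=; have := c_gt0 i; lra.
- rewrite all_rcons; apply/andP; split; first by rewrite -splitr.
  by apply: sub_all sa => j /=; have := c_gt0 i; lra.
Qed.

(** With [k] a lower bound for [p * (1 - p)], the number of separated stakes required depends on [k]
    and [e] alone. *)
Lemma bern_window_small c p n r a (s : seq nat) k e :
  0 <= p <= 1 -> 0 <= r -> all (gtn n) s ->
  pairwise (fun i j => r <= c i - c j) s ->
  0 < k -> k <= p * (1 - p) -> 0 < e -> 2 <= (size s)%:R * (k * e) ->
  bern_window c p n r a <= e.
Proof.
move=> hp r0 sn sP k0 kp e0 he; rewrite leNgt; apply/negP => ew.
have := bern_window_anticoncentration c p n r a s hp r0 sn sP.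
have s0 : 0 < (size s)%:R :> R.
  by rewrite lt_neqAle ler0n andbT; apply: contraTneq he => <-; rewrite mul0r; lra.
have : k * e < p * (1 - p) * bern_window c p n r a.
  by rewrite (lt_le_trans (y := k * bern_window c p n r a)) ?ltr_pM2l// ler_wpM2r//; lra.
by rewrite -(ltr_pM2l s0); lra.
Qed.

Lemma archi_mul_ge x (y : R) : 0 < x -> exists m : nat, y <= m%:R * x.
Proof.
move=> x0; exists (Num.Def.archi_bound `|y / x|); rewrite -ler_pdivrMr//.
by rewrite (le_trans (ler_norm _))// ltW// archi_boundP.
Qed.

(* If infinitely many stakes are positive, they take infinitely many separated
   values, so the window [t - rest, t) has small probability. *)
Lemma bern_tail_rest_le c p t e : stake_seq c -> 0 < p < 1 -> 0 < e ->
  exists n, bern_tail c p n (t - stake_rest c n) <= bern_tail c p n t + e.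
Proof.
move=> hc hp e0; have hp' : 0 <= p <= 1 by lra.
(* Past a zero stake all stakes vanish, so the rest is constant from there on; as it tends to 0, it
   is 0. *)
have [[k ck0]|/forallNP c_neq0] := pselect (exists k, c k = 0).
  exists k; suff -> : stake_rest c k = 0 by rewrite subr0; lra.
  have restE n : stake_rest c (k + n) = stake_rest c k.
    elim: n => [|n IH]; first by rewrite addn0.
    rewrite addnS stake_restS IH; have [c0 _] := hc.
    suff -> : c (k + n)%N = 0 by rewrite subr0.
    by apply/eqP; rewrite eq_le c0 -ck0 stake_anti// leq_addr.
  apply/eqP; rewrite eq_le stake_rest_ge0// andbT leNgt; apply/negP => r0.
  have [N /(_ (k + N)%N)] : exists N, forall n, (N <= n)%N ->
    stake_rest c n <= stake_rest c k / 2 by apply: stake_rest_small => //; lra.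
  by rewrite leq_addl restE => /(_ isT); lra.
have c_gt0 i : 0 < c i.
  by have [c0 _] := hc; rewrite lt_neqAle c0 andbT eq_sym; apply/eqP/c_neq0.
have k0 : 0 < p * (1 - p) by rewrite mulr_gt0; lra.
have [m hm] := archi_mul_ge _ 2 (mulr_gt0 k0 e0).
have [s [r [r0 ss sP _]]] := separated_stakes c m hc c_gt0.
have [N hN] := stake_rest_small hc _ r0.
(* The rest must fit into the window width [r], and all chosen stakes must have index below [n]. *)
pose n := maxn N (\max_(i <- s) i).+1; exists n.
have hn : stake_rest c n <= r by rewrite hN// leq_maxl.
have sn : all (gtn n) s.
  by apply/allP => i si /=; rewrite leq_max orbC ltnS leq_bigmax_seq.
have := @bern_window_small c p n r (t - r) s _ e hp' (ltW r0) sn sP k0 (lexx _) e0.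
rewrite ss => /(_ hm); rewrite /bern_window subrK.
have : bern_tail c p n (t - stake_rest c n) <= bern_tail c p n (t - r).
  by apply: bern_tail_anti => //; lra.
by lra.
Qed.

(** The squares of the stakes from [k] on sum to at most [c k * stake_rest c k], hence to at most
    [eta * stake_rest c k ^+ 2], while [b] exceeds the mean by at least [dl * stake_rest c k]. *)
Lemma bern_tail_chebyshev_block c p k N b (dl eta : R) : stake_seq c -> 0 <= p <= 1 ->
  0 < dl -> 0 < stake_rest c k -> c k <= eta * stake_rest c k ->
  p * (stake_rest c k - stake_rest c (k + N)) + dl * stake_rest c k <= b ->
  bern_tail (fun i => c (k + i)%N) p N b <= eta / dl ^+ 2.
Proof.
move=> hc hp dl0 r0 ck hb; have [c0 _] := hc.
set c' := fun i => c (k + i)%N; set mu := p * (\sum_(0 <= i < N) c' i).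
have muE : mu = p * (stake_rest c k - stake_rest c (k + N)).
  by rewrite /mu stake_sum_block.
have drk0 : 0 < dl * stake_rest c k by exact: mulr_gt0.
have mub : mu <= b by rewrite muE; lra.
have := bern_tail_second_moment c' p N b mu hp mub.
rewrite subrr expr0n addr0 /= => h.
have hV : \sum_(0 <= i < N) c' i ^+ 2 <= eta * stake_rest c k ^+ 2.
  apply: (@le_trans _ _ (\sum_(0 <= i < N) c k * c' i)).
    apply: ler_sum => i _; rewrite expr2; apply: ler_wpM2r; first exact: c0.
    exact: (stake_anti hc _ _ (leq_addr i k)).
  rewrite -mulr_sumr stake_sum_block expr2 mulrA.
  apply: ler_pM => //; first by rewrite subr_ge0; apply: stake_rest_anti; rewrite ?leq_addr.
  by have := stake_rest_ge0 hc (k + N); lra.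
have h2 : bern_tail c' p N b * (dl * stake_rest c k) ^+ 2 <= eta * stake_rest c k ^+ 2.
  apply: le_trans hV; apply: le_trans h; apply: ler_wpM2l; first exact: bern_tail_ge0.
  by rewrite ler_sqr ?nnegrE; rewrite muE in mub *; lra.
rewrite ler_pdivlMr ?exprn_gt0//.
by move: h2; rewrite exprMn mulrA ler_pM2r// exprn_gt0.
Qed.

Lemma expr_small (x y : R) : 0 <= x < 1 -> 0 < y -> exists n, x ^+ n <= y.
Proof.
move=> /andP[x0 x1] y0; have xn : `|x| < 1 by rewrite ger0_norm.
have /cvgrPdist_le/(_ y y0)[N _ hN] := cvg_expr xn.
exists N; have /= := hN N (leqnn N); rewrite sub0r normrN; apply: le_trans.
exact: ler_norm.
Qed.

(** A heavy stake shrinks the rest by a factor [1 - eta], so [L] of them shrink it by [eta / 2].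
    Hence the stake at [i * L] exceeds [eta] times its rest, while the stake at any later multiple
    of [L] and the final rest are each at most half of that. *)
Lemma heavy_stakes_separated c (eta : R) m L : stake_seq c -> 0 < eta < 1 ->
  (forall k, (k < m * L)%N -> eta * stake_rest c k < c k) ->
  (1 - eta) ^+ L <= eta / 2 ->
  pairwise (fun i j => stake_rest c (m * L) <= c i - c j)
    [seq (j * L)%N | j <- iota 0 m].
Proof.
move=> hc heta bad hL.
have L0 : (0 < L)%N by case: L hL {bad} => //; rewrite expr0; lra.
have dec k j : (k + j <= m * L)%N ->
    stake_rest c (k + j) <= (1 - eta) ^+ j * stake_rest c k.
  elim: j => [|j IH] kj; first by rewrite addn0 expr0 mul1r.
  rewrite addnS stake_restS exprS -mulrA.
  rewrite addnS in kj; have h1 := bad _ kj.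
  have e1 : 0 <= 1 - eta by lra.
  by have := ler_wpM2l e1 (IH (ltnW kj)); lra.
rewrite pairwise_map; apply/(pairwiseP 0%N) => i j; rewrite !inE size_iota => im jm ij.
rewrite /= !nth_iota// !add0n.
have iL : (i * L < m * L)%N by rewrite ltn_pmul2r.
have i1 : (i * L + L <= m * L)%N by rewrite addnC -mulSn leq_pmul2r.
have h1 := bad _ iL; have h2 := dec _ _ i1.
have h3 : stake_rest c (m * L) <= stake_rest c (i * L + L) by exact: stake_rest_anti.
have h4 : stake_rest c (j * L) <= stake_rest c (i * L + L).
  by apply: stake_rest_anti => //; rewrite addnC -mulSn leq_mul2r ij orbT.
have h5 := stake_le_rest hc (j * L).
have h6 := ler_wpM2r (stake_rest_ge0 hc (i * L)) hL.
by lra.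
Qed.

(* Either some early stake is negligible against the remainder, which is then close
   to its mean, or the first [K] stakes are heavy and smooth out the sum. *)
Lemma bern_tail_uniform t (lo hi : R) e : t <= 1 -> 0 < lo -> hi < t -> 0 < e <= 1 ->
  exists K : nat, forall c p, stake_seq c -> lo <= p <= hi ->
  exists k a n, [/\ (k <= K)%N, 0 < a, t * (1 - stake_rest c k) <= a &
    bern_tail c p n (t - stake_rest c n) <= bern_tail c p k a + e].
Proof.
move=> t1 lo0 hit he; have [hilo|lohi] := ltP hi lo.
  by exists 0%N => c p _ hp; exfalso; move: hp; lra.
pose dl := t - hi; have dl0 : 0 < dl by rewrite /dl; lra.
have dl1 : dl < 1 by rewrite /dl; lra.
(* Chosen so that the Chebyshev error [eta / (dl / 4) ^+ 2] is exactly [e]. *)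
pose eta := e * (dl / 4) ^+ 2.
have eta0 : 0 < eta by rewrite mulr_gt0 ?exprn_gt0 ?divr_gt0//; lra.
have eta1 : eta < 1 by rewrite /eta expr2; nra.
have k0 : 0 < lo * (1 - hi) by rewrite mulr_gt0//; lra.
have e0 : 0 < e by lra.
have [m hm] := archi_mul_ge _ 2 (mulr_gt0 k0 e0).
have [L hL] : exists L, (1 - eta) ^+ L <= eta / 2 by apply: expr_small; lra.
exists (m * L)%N => c p hc plh; have hp : 0 <= p <= 1 by lra.
have [[k [kK ck]]|/forallNP bad] := pselect
    (exists k, (k < m * L)%N /\ c k <= eta * stake_rest c k).
  have := stake_rest_ge0 hc k; rewrite le_eqVlt => /predU1P[rk|rk0].
    exists k, t, k; split; [exact: ltnW|lra|rewrite -rk; lra|].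
    by rewrite -rk subr0; lra.
  have rk1 : stake_rest c k <= 1.
    by rewrite /stake_rest gerBl sumr_ge0// => i _; have [] := hc.
  have dr0 : 0 < dl / 4 * stake_rest c k by rewrite mulr_gt0//; lra.
  have [N hN] := stake_rest_small hc _ dr0.
  have hkN := hN _ (leq_addl k N).
  (* In units of [stake_rest c k], the block has mean at most [t - dl] and is allotted [t - dl / 2].
     Of the margin [dl / 2], up to [dl / 4] goes to the rest after the block and [dl / 4] remains
     for Chebyshev. *)
  exists k, (t - (t - dl / 2) * stake_rest c k), (k + N)%N; split.
  - exact: ltnW.
  - have : (t - dl / 2) * stake_rest c k <= t - dl / 2.
      by rewrite ler_piMr// /dl; lra.
    by lra.
  - by rewrite -subr_ge0; have : 0 < dl / 2 * stake_rest c k by [rewrite mulr_gt0//; lra]; lra.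
  have -> : t - stake_rest c (k + N) = (t - (t - dl / 2) * stake_rest c k) +
    ((t - dl / 2) * stake_rest c k - stake_rest c (k + N)) by ring.
  apply: (le_trans (bern_tail_split _ _ _ _ _ _ hp)); rewrite lerD2l.
  have -> : e = eta / (dl / 4) ^+ 2 by rewrite /eta mulfK// expf_neq0//; lra.
  apply: bern_tail_chebyshev_block => //; first by lra.
  have rN0 := stake_rest_ge0 hc (k + N).
  have : p * (stake_rest c k - stake_rest c (k + N)) <= (t - dl) * stake_rest c k.
    apply: ler_pM; [lra| |rewrite /dl; lra|lra].
    by rewrite subr_ge0; apply: stake_rest_anti => //; exact: leq_addr.
  by lra.
exists (m * L)%N, t, (m * L)%N; split => //; first by lra.
  by rewrite ler_piMr ?gerBl ?stake_rest_ge0//; lra.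
have heta : 0 < eta < 1 by lra.
have sep := @heavy_stakes_separated c eta m L hc heta _ hL.
have {}bad k : (k < m * L)%N -> eta * stake_rest c k < c k.
  by move=> kK; rewrite ltNge; apply/negP => h; exact: (bad k).
have L0 : (0 < L)%N by case: L hL {sep bad} => //; rewrite expr0; lra.
have sn : all (gtn (m * L)) [seq (j * L)%N | j <- iota 0 m].
  rewrite all_map; apply/allP => j; rewrite mem_iota add0n /= => jm.
  by rewrite ltn_pmul2r.
have := @bern_window_small c p (m * L) (stake_rest c (m * L)) (t - stake_rest c (m * L))
  _ (lo * (1 - hi)) e hp (stake_rest_ge0 hc _) sn (sep bad) k0 _ e0.
rewrite size_map size_iota /bern_window subrK lerBlDl => -> //.
by apply: ler_pM; lra.
Qed.

Lemma stake_truncate c k : stake_seq c -> 0 < 1 - stake_rest c k ->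
  stake_seq (fun i => if (i < k)%N then c i / (1 - stake_rest c k) else 0).
Proof.
move=> hc C0; have [c0 [cS _]] := hc; set C := 1 - _ in C0 *.
split=> [i|]; first by case: ifP => // _; rewrite divr_ge0// ltW.
split=> [i|].
  case: ifP => [ik|_]; first by rewrite (ltnW ik) ler_pM2r ?invr_gt0.
  by case: ifP => // _; rewrite divr_ge0// ltW.
apply: cvg_near_cst; exists k => // n /= kn; rewrite /series/=.
rewrite (big_cat_nat (n := k))//= [X in _ + X]big_nat_cond [X in _ + X]big1 ?addr0; last first.
  by move=> i /andP[/andP[ki _] _]; rewrite ltnNge ki.
rewrite big_nat_cond; under eq_bigr => i /andP[/andP[_ ->] _] do over.
rewrite -big_nat_cond -mulr_suml.
have -> : \sum_(0 <= i < k) c i = C by rewrite /C /stake_rest; ring.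
by rewrite divff// gt_eqF.
Qed.

(** Staking everything on one variable shows that the supremum is over a nonempty set, and yields
    the lower bound [p] at threshold 1. *)
Lemma stake_seq_unit : stake_seq (fun i => (i == 0)%N%:R : R).
Proof.
split=> [i|]; first exact: ler0n.
split=> [i|]; first by rewrite ler_nat.
apply: cvg_near_cst; exists 1%N => // n /= n1; rewrite /series/=.
by case: n n1 => // n _; rewrite big_nat_recl//= big1 ?addr0.
Qed.

End Approximation.

(** * Continuity in p *)

Section Pi.
Context {R : realType} {d : measure_display} {T : measurableType d}.
Context {P : R -> probability T R} {beta : nat -> T -> R}.
Hypothesis hP : forall p : R, 0 <= p <= 1 -> iid_bernoulli (P p) p beta.
Implicit Types (c : nat -> R) (p q t a : R).

Local Notation f t p := (fine (pi_fun P beta p t)).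

Lemma pi_fun_ge c p t : stake_seq c ->
  (P p [set w | (t <= stake_sum c beta w)%R] <= pi_fun P beta p t)%E.
Proof. by move=> hc; apply: ereal_sup_ubound; exists c. Qed.

Lemma pi_fun_fineK p t : 0 <= p <= 1 -> (f t p)%:E = pi_fun P beta p t.
Proof.
move=> hp; rewrite fineK// ge0_fin_numE.
  rewrite (@le_lt_trans _ _ 1%E) ?ltry//; apply: ge_ereal_sup => _ [c hc <-].
  by apply: probability_le1; exact: (measurable_stake_event (hP _ hp)).
exact: le_trans (pi_fun_ge _ _ _ stake_seq_unit).
Qed.

Lemma pi_le p t x : 0 <= p <= 1 ->
  (forall c, stake_seq c -> (P p [set w | (t <= stake_sum c beta w)%R] <= x%:E)%E) ->
  f t p <= x.
Proof.
move=> hp h; rewrite -lee_fin pi_fun_fineK//.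
by apply: ge_ereal_sup => _ [c hc <-]; exact: h.
Qed.

Lemma pi_ge_tail c p t n : 0 <= p <= 1 -> stake_seq c ->
  bern_tail c p n t <= f t p.
Proof.
move=> hp hc; rewrite -lee_fin pi_fun_fineK//.
by apply: le_trans (pi_fun_ge _ _ _ hc); exact: (prob_stake_ge (hP _ hp)).
Qed.

Lemma pi_ge0 p t : 0 <= p <= 1 -> 0 <= f t p.
Proof.
move=> hp; apply: le_trans (pi_ge_tail _ _ t 0 hp stake_seq_unit).
exact: bern_tail_ge0.
Qed.

Lemma pi_le1 p t : 0 <= p <= 1 -> f t p <= 1.
Proof.
move=> hp; apply: pi_le => // c hc.
by apply: probability_le1; exact: (measurable_stake_event (hP _ hp)).
Qed.

Lemma pi1_ge p : 0 <= p <= 1 -> p <= f 1 p.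
Proof.
move=> hp; apply: le_trans (pi_ge_tail _ _ 1 1 hp stake_seq_unit).
by rewrite /= subrr lexx ler10 mulr1 mulr0 addr0.
Qed.

Lemma pi_markov p t : 0 <= p <= 1 -> 0 < t -> f t p <= 2 * p / t.
Proof.
move=> hp t0; have /andP[p0 p1] := hp; apply: pi_le => // c hc.
(* A rest of at most [t / 2] leaves a threshold of at least [t / 2], whence the factor 2. *)
have [N /(_ N (leqnn N)) hN] : exists N, forall n, (N <= n)%N -> stake_rest c n <= t / 2.
  by apply: stake_rest_small => //; rewrite divr_gt0.
apply: (le_trans (prob_stake_le (hP _ hp) _ _ N hc)); rewrite lee_fin ler_pdivlMr//.
have [c0 _] := hc.
have := bern_tail_markov c p N (t - stake_rest c N) c0 hp.
have -> : \sum_(0 <= i < N) c i = 1 - stake_rest c N by rewrite /stake_rest; ring.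
have := bern_tail_ge0 c p N (t - stake_rest c N) hp.
move: (bern_tail _ _ _ _) => b b0.
have : 0 <= p * stake_rest c N by rewrite mulr_ge0// stake_rest_ge0.
have : b * (t / 2) <= b * (t - stake_rest c N) by apply: ler_wpM2l => //; lra.
by lra.
Qed.

(* Discarding the stakes from [k] on and renormalising the others lowers the
   threshold from [t] to [t * (1 - stake_rest c k)]. *)
Lemma pi_ge_rescaled c q t k a : 0 <= q <= 1 -> stake_seq c -> 0 < a ->
  t * (1 - stake_rest c k) <= a -> bern_tail c q k a <= f t q.
Proof.
move=> hq hc a0 ha; have [c0 _] := hc.
have sumE : \sum_(0 <= i < k) c i = 1 - stake_rest c k by rewrite /stake_rest; ring.
have : 0 <= 1 - stake_rest c k by rewrite -sumE sumr_ge0.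
(* A head of total 0 cannot be renormalised, but it cannot reach [a > 0] either. *)
rewrite le_eqVlt => /predU1P[C0|C0].
  by rewrite bern_tail_eq0 ?pi_ge0// sumE -C0.
apply: le_trans (pi_ge_tail _ q t k hq (stake_truncate c k hc C0)).
rewrite [leRHS](eq_bern_tail _ (fun i => c i / (1 - stake_rest c k))); last first.
  by move=> i /= ->.
rewrite -(bern_tail_scale c q k a _ C0); apply: bern_tail_anti => //.
by rewrite ler_pdivlMr.
Qed.

(** Only the first [k <= K] stakes matter up to [e], and their tail is [K]-Lipschitz in the
    probability. Since [K] serves all [p] and [q] in the range, the two may be exchanged. *)
Lemma pi_uniform t (lo hi : R) e : t <= 1 -> 0 < lo -> hi < t -> 0 < e <= 1 ->
  exists K : nat, forall p q, lo <= p <= hi -> lo <= q <= hi ->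
    f t p <= f t q + K%:R * `|p - q| + e.
Proof.
move=> t1 lo0 hit he; have [K hK] := bern_tail_uniform t lo hi e t1 lo0 hit he.
exists K => p q plh qlh.
have hp : 0 <= p <= 1 by lra. have hq : 0 <= q <= 1 by lra.
apply: pi_le => // c hc; have [k [a [n [kK a0 ha hn]]]] := hK c p hc plh.
apply: (le_trans (prob_stake_le (hP _ hp) _ _ n hc)); rewrite lee_fin.
apply: (le_trans hn); rewrite lerD2r.
apply: (le_trans (bern_tail_lip c p q k a hp hq)); apply: lerD.
  exact: pi_ge_rescaled.
by rewrite ler_wpM2r// ler_nat.
Qed.

Lemma pi_mono p q t : 0 < p < 1 -> p <= q <= 1 -> f t p <= f t q.
Proof.
move=> hp hq; apply/ler_addgt0Pr => e e0.
have hp' : 0 <= p <= 1 by lra. have hq' : 0 <= q <= 1 by lra.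
apply: pi_le => // c hc; have [n hn] := bern_tail_rest_le c p t e hc hp e0.
apply: (le_trans (prob_stake_le (hP _ hp') _ _ n hc)); rewrite lee_fin.
apply: (le_trans hn); rewrite lerD2r.
apply: le_trans (pi_ge_tail c q t n hq' hc).
by have [c0 _] := hc; apply: bern_tail_mono => //; lra.
Qed.

(** A nearly optimal sequence for [p], cut at [n], still competes at [q]. As [n] depends on [p],
    this bounds [f t q] only from below. *)
Lemma pi_lsc p t e : 0 < p < 1 -> 0 < e ->
  exists n : nat, forall q, 0 <= q <= 1 -> f t p <= f t q + n%:R * `|p - q| + e.
Proof.
move=> hp e0; have hp' : 0 <= p <= 1 by lra.
have e2 : 0 < e / 2 by lra.
have [[c [hc hcp]]|/forallNP h] := pselect (exists c, stake_seq c /\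
    ((f t p - e / 2)%:E < P p [set w | (t <= stake_sum c beta w)%R])%E); last first.
  have : f t p <= f t p - e / 2; last by lra.
  by apply: pi_le => // c hc; rewrite leNgt; apply/negP => hlt; exact: (h c).
have [n hn] := bern_tail_rest_le c p t (e / 2) hc hp e2.
exists n => q hq; have := lt_le_trans hcp (prob_stake_le (hP _ hp') _ _ n hc).
rewrite lte_fin; have := bern_tail_lip c p q n t hp' hq.
by have := pi_ge_tail c q t n hq hc; lra.
Qed.

End Pi.

(** * Continuity on the interval, by the position of p *)

Lemma continuous_within_epsP {R : realType} (A : set R) (f : R -> R) :
  (forall x, A x -> forall e, 0 < e -> exists dl, 0 < dl /\
    forall y, A y -> `|x - y| <= dl -> `|f x - f y| <= e) ->
  {within A, continuous f}.
Proof.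
move=> h; apply/subspace_continuousP => x Ax; apply/cvgrPdist_le => e e0.
have [dl [dl0 hdl]] := h x Ax e e0.
have /cvgrPdist_le/(_ _ dl0) : y @[y --> x] --> x by exact: cvg_id.
by rewrite near_withinE; apply: filterS => y xy Ay; exact: hdl.
Qed.

Theorem theorem8 (R : realType) (d : measure_display) (T : measurableType d)
  (P : R -> probability T R) (beta : nat -> T -> R)
  (hP : forall p : R, 0 <= p <= 1 -> iid_bernoulli (P p) p beta)
  (t : R) (ht : 0 < t <= 1) :
  {within `[0, t], continuous (fun p : R => fine (pi_fun P beta p t))}.
Proof.
(* Dividing by [n.+1] keeps the radius meaningful for [n = 0]. *)
have dist_le (x y : R) n (e : R) : 0 < e ->
    `|x - y| <= e / n.+1%:R -> n%:R * `|x - y| <= e.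
  move=> e0; rewrite ler_pdivlMr ?ltr0n// -natr1.
  by have := normr_ge0 (x - y); lra.
apply: continuous_within_epsP => p /=; rewrite in_itv/= => hpt e e0.
have hp : 0 <= p <= 1 by lra.
have p_cases : [\/ p = 0, 0 < p < t, p = t /\ t = 1 | p = t /\ 0 < t < 1].
  have [->|p0] := eqVneq p 0; first by constructor 1.
  have {}p0 : 0 < p by rewrite lt_neqAle eq_sym p0; case/andP: hpt.
  have [pt|pt] := ltP p t; first by constructor 2; lra.
  have -> : p = t by lra.
  by have [t1|t1] := ltP t 1; [constructor 4; lra|constructor 3; lra].
case: p_cases => [p0|h0|[pt t1]|[pt h0]].
- exists (e * t / 2); split; first by rewrite divr_gt0// mulr_gt0//; lra.
  move=> q; rewrite /= in_itv/= => hqt; have hq : 0 <= q <= 1 by lra.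
  have t0 : 0 < t by lra.
  have := pi_markov hP q t hq t0; have := pi_markov hP p t hp t0.
  have := pi_ge0 hP q t hq; have := pi_ge0 hP p t hp.
  rewrite p0 sub0r normrN mulr0 mul0r => h1 h2 h3 h4.
  rewrite ger0_norm; last by lra.
  move=> hqe; have : 2 * q / t <= e by rewrite ler_pdivrMr//; lra.
  by rewrite ler_norml; lra.
- have e1 : 0 < Num.min (e / 2) 1 <= 1.
    by rewrite lt_min ge_min lexx orbT ltr01 !andbT divr_gt0.
  have lo0 : 0 < p / 2 by lra. have hit : (p + t) / 2 < t by lra.
  have t1 : t <= 1 by lra.
  have [K hK] := pi_uniform hP t (p / 2) ((p + t) / 2) _ t1 lo0 hit e1.
  have he : Num.min (e / 2) 1 <= e / 2 by rewrite ge_min lexx.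
  (* The first two bounds keep [q] between [p / 2] and [(p + t) / 2], where the uniform estimate
     applies in both directions. *)
  exists (Num.min (Num.min (p / 2) ((t - p) / 2)) (e / 2 / K.+1%:R)); split.
    by rewrite !lt_min !divr_gt0//; lra.
  move=> q; rewrite /= in_itv/= => hqt; rewrite !le_min => /andP[/andP[h1 h2] h3].
  have {}h3 : K%:R * `|p - q| <= e / 2 by apply: dist_le => //; lra.
  have plh : p / 2 <= p <= (p + t) / 2 by lra.
  have qlh : p / 2 <= q <= (p + t) / 2 by move: h1 h2; rewrite !ler_norml; lra.
  have := hK p q plh qlh; have := hK q p qlh plh; rewrite (distrC q) ler_norml.
  by lra.
(* At [p = t = 1] both values lie between [q] and 1, so they differ by at most [1 - q]. *)
- exists e; split=> // q; rewrite /= in_itv/= => hqt; have hq : 0 <= q <= 1 by lra.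
  rewrite pt t1 in hqt hp *; have := pi1_ge hP q hq; have := pi1_ge hP 1 hp.
  have := pi_le1 hP q 1 hq; have := pi_le1 hP 1 1 hp.
  by rewrite !ler_norml; lra.
- have e2 : 0 < e / 2 by lra.
  have hp' : 0 < p < 1 by lra.
  have [n hn] := pi_lsc hP p t (e / 2) hp' e2.
  (* The bound [t / 2] keeps [q] positive, so that monotonicity applies; [q <= t = p] holds on the
     interval. *)
  exists (Num.min (t / 2) (e / 2 / n.+1%:R)); split.
    by rewrite !lt_min !divr_gt0//; lra.
  move=> q; rewrite /= in_itv/= => hqt; rewrite !le_min => /andP[h1 h2].
  have {}h2 : n%:R * `|p - q| <= e / 2 by apply: dist_le => //; lra.
  have hq : 0 <= q <= 1 by lra.
  have hq' : 0 < q < 1 by move: h1; rewrite ler_norml; lra.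
  have hqp : q <= p <= 1 by lra.
  have := hn q hq; have := pi_mono hP q p t hq' hqp; rewrite ler_norml.
  by lra.
Qed.
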